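(* Let $K$ be a field, let $B = K \oplus \mathfrak{b}$ be an augmented (associative, unital) $K$-algebra with augmentation ideal $\mathfrak{b}$, let $X$ be a generating set for $\mathfrak{b}$ as left $B$-module, and let $R$ be a relating set for the left $B$-module $\mathfrak{b}$ when generated by $X$. If $1 \le |X| = \dim_K(\mathfrak{b}/\mathfrak{b}^2) < \aleph_0$ and $|R| \le \frac{1}{4}|X|^2$, then $\dim_K(B) \ge \aleph_0$.
   Context: An augmented $K$-algebra $B = K\oplus\mathfrak{b}$ is an associative unital $K$-algebra with a $K$-algebra homomorphism $B\to K$ whose kernel is the two-sided ideal $\mathfrak{b}$. That $X$ is a generating set and $R$ a relating set for $\mathfrak{b}$ means that there is an exact sequence of left $B$-modules $\bigoplus_{R} B \xrightarrow{\partial} \bigoplus_{X} B \xrightarrow{\pi} \mathfrak{b} \to 0$, where $\bigoplus_{R} B$ and $\bigoplus_X B$ denote the direct sums of copies of $B$ indexed by $R$ and $X$ respectively, and $\pi$ sends the basis element indexed by $x\in X$ to the generator $x \in\mathfrak{b}$. *)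

(* Defs.v *)
From HB Require Import structures.
From mathcomp Require Import all_boot all_order all_algebra.
From mathcomp Require Import finmap.
From mathcomp Require Import all_classical.

Set Implicit Arguments.
Unset Strict Implicit.
Unset Printing Implicit Defensive.

Import Order.TTheory GRing.Theory Num.Theory.
Local Open Scope classical_set_scope.
Local Open Scope card_scope.
Local Open Scope ring_scope.

(* E is a set of representatives, lying in V, of a basis of the quotient V / W
   of the subspaces W <= V of M.  Linear independence modulo W makes the
   elements of E pairwise distinct modulo W, so that E has the cardinality of
   a basis of V / W. *)
Definition basis_mod (K : fieldType) (M : lmodType K) (V W E : set M) : Prop :=
  [/\ E `<=` V,
      (forall v, V v -> exists (S : {fset M}) (c : M -> K),
         [set` S] `<=` E /\ W (v - \sum_(x <- S) c x *: x))
    & (forall (S : {fset M}) (c : M -> K), [set` S] `<=` E ->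
         W (\sum_(x <- S) c x *: x) -> forall x, x \in S -> c x = 0)].

Definition quotient_dim_eq (K : fieldType) (M : lmodType K) (V W : set M)
    (T : Type) (A : set T) : Prop :=
  exists E : set M, basis_mod V W E /\ E #= A.

Definition dim_ge_aleph0 (K : fieldType) (M : lmodType K) : Prop :=
  exists E : set M, basis_mod [set: M] [set 0] E /\ [set: nat] #<= E.

Definition augmentation_ideal (K : fieldType) (B : algType K)
    (eps : {lrmorphism B -> K^o}) : set B :=
  [set x | eps x = 0].

Definition ideal_square (B : nzRingType) (I : set B) : set B :=
  [set x | exists s : seq (B * B),
     (forall p, p \in s -> I p.1 /\ I p.2) /\ x = \sum_(p <- s) p.1 * p.2].

(* Exactness of (+)_R B -> (+)_X B -> I -> 0 for a left ideal I of B.  As X and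
   R are finite, the direct sums are modules of finite functions; B^o is B as a
   left module over itself, and the map onto I is taken with values in B^o. *)
Definition generating_relating (B : nzRingType) (I : set B)
    (X : {fset B}) (R : finType) : Prop :=
  exists (d : {linear {ffun R -> B^o} -> {ffun X -> B^o}})
         (pi : {linear {ffun X -> B^o} -> B^o}),
    [/\ forall x : X, pi [ffun y => (y == x)%:R] = fsval x,
        range d = [set u | pi u = 0]
      & range pi = I].

(* Main.v *)
(* Golod-Shafarevich argument.  Suppose dim B is finite and let I be the
   augmentation ideal.  Since X has dim (I / I^2) elements, it is a basis of I
   modulo I^2, so every relation between the elements of X has its coefficients
   in I.  Hence the exact sequence B^R -> B^X -> I -> 0 induces, for each n, an
   exact sequence (B/I^n)^R -> (B/I^(n+1))^X -> I/I^(n+2) -> 0, and the numbers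
   c_n = dim (B/I^n) satisfy
     c_(n+2) >= |X| c_(n+1) - |R| c_n + 1.
   For |R| <= |X|^2 / 4 this gives 2 c_(n+1) >= |X| c_n + 2 by induction, so
   that c is strictly increasing, contradicting c_n <= dim B. *)
Require Import Defs.
From HB Require Import structures.
From mathcomp Require Import all_boot all_order all_algebra all_field.
From mathcomp Require Import finmap.
From mathcomp Require Import all_classical.
From mathcomp Require Import zify.

Set Implicit Arguments.
Unset Strict Implicit.
Unset Printing Implicit Defensive.

Import Order.TTheory GRing.Theory Num.Theory.
Local Open Scope classical_set_scope.
Local Open Scope ring_scope.

(** * Existence of bases by Zorn's lemma *)

Definition lin_indep (K : fieldType) (M : lmodType K) (E : set M) : Prop :=
  forall (S : {fset M}) (c : M -> K), [set` S] `<=` E ->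
    \sum_(x <- S) c x *: x = 0 -> forall x, x \in S -> c x = 0.

Lemma seq_sub_chain (T : eqType) (F : set (set T)) (s : seq T) :
  total_on F subset -> F !=set0 ->
  (forall x, x \in s -> (\bigcup_(X in F) X) x) ->
  exists2 X, F X & forall x, x \in s -> X x.
Proof.
move=> Ftot F0; elim: s => [|a s IH] sF.
  by have [X FX] := F0; exists X.
have [|X FX sX] := IH; first by move=> x xs; apply: sF; rewrite inE xs orbT.
have [Y FY Ya] : (\bigcup_(X in F) X) a by apply: sF; rewrite mem_head.
have [XY|YX] := Ftot _ _ FX FY.
  by exists Y => // x; rewrite inE => /predU1P[->//|/sX/XY].
by exists X => // x; rewrite inE => /predU1P[->|/sX//]; apply: YX.
Qed.

(** A relation involves finitely many vectors, and these already lie in one member of the chain.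
    This is the chain condition for Zorn's lemma. *)
Lemma lin_indep_bigcup (K : fieldType) (M : lmodType K) (F : set (set M)) :
  F `<=` @lin_indep K M -> total_on F subset ->
  lin_indep (\bigcup_(X in F) X).
Proof.
move=> Find Ftot S c SF Sc x xS.
have F0 : F !=set0 by have [X FX _] := SF _ xS; exists X.
have [X FX SX] := seq_sub_chain Ftot F0 SF.
exact: (Find _ FX S).
Qed.

Lemma exists_basis (K : fieldType) (M : lmodType K) :
  exists E : set M, basis_mod [set: M] [set 0] E.
Proof.
have [E [Eind Emax]] := Zorn_bigcup (@lin_indep_bigcup K M).
exists E; split=> // v _.
apply: contrapT => nv.
have nvE : ~ E v.
  move=> Ev; apply: nv; exists [fset v]%fset, (fun=> 1); split.
    by move=> x /=; rewrite inE => /eqP->.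
  by rewrite /= big_seq_fset1 scale1r subrr.
apply: (Emax (E `|` [set v])).
  by split; [exact: subsetUl | move=> /(_ v) h; apply/nvE/h; right].
move=> S c SE Sc.
have SvE : [set` (S `\ v)%fset] `<=` E.
  by move=> x /=; rewrite !inE => /andP[/eqP xv /SE[]].
have [vS|vS] := boolP (v \in S); last first.
  by apply: Eind Sc => x xS; have [//|xv] := SE x xS; rewrite -xv xS in vS.
move: Sc; rewrite (big_fsetD1 v)//= => Sc.
(* Otherwise dividing the relation by [c v] would write [v] as a combination of elements of [E],
   against [nv]. *)
have cv0 : c v = 0.
  apply/eqP/negPn/negP => cv0; apply: nv.
  exists (S `\ v)%fset, (fun x => - (c v)^-1 * c x); split=> //=.
  apply: (scalerI cv0); rewrite scaler0 scalerBr scaler_sumr -[RHS]Sc.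
  congr (_ + _); rewrite -sumrN; apply: eq_bigr => x _.
  by rewrite scalerA mulNr mulrN mulVKf// scaleNr opprK.
move: Sc; rewrite cv0 scale0r add0r => /(Eind _ _ SvE) Sc x xS.
have [->//|xv] := eqVneq x v; apply: Sc.
by rewrite !inE xv.
Qed.

(** * Finite bases and finite-dimensional algebra structures *)

Lemma finite_basis_vector (K : fieldType) (M : lmodType K) (S : {fset M}) :
  basis_mod [set: M] [set 0] [set` S] -> Vector.axiom #|` S| M.
Proof.
move=> [_ Sspan Sind].
pose g (r : 'rV[K]_#|` S|) : M := \sum_i r 0 i *: S`_i.
have gE c : \sum_(x <- S) c x *: x = g (\row_i c S`_i).
  by rewrite (big_nth 0) big_mkord; apply: eq_bigr => i _; rewrite mxE.
have g_lin : linear g.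
  move=> a u v; rewrite /g scaler_sumr -big_split; apply: eq_bigr => i _ /=.
  by rewrite !mxE scalerDl scalerA.
have g_inj r : g r = 0 -> r = 0.
  (* The row becomes a function on [M] through positions in [S]; outside [S] the index is out of
     range and the default is 0. *)
  pose c x := if insub (index x S) is Some i then r 0 i else 0.
  have cE (i : 'I_#|` S|) : c S`_i = r 0 i.
    by rewrite /c index_uniq ?fset_uniq// valK.
  have -> : g r = \sum_(x <- S) c x *: x.
    by rewrite gE; congr g; apply/rowP => i; rewrite mxE cE.
  move=> /Sind c0; apply/rowP => i; rewrite mxE -cE; apply: c0 => //.
  by rewrite mem_nth.
have g_surj v : exists r, g r = v.
  have [T [c [TS /= /eqP]]] := Sspan v I.
  rewrite subr_eq0 => /eqP ->.
  (* [Sspan] gives coefficients on a subset [T] of [S] only; they are extended by zero to all of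
     [S]. *)
  exists (\row_i (if S`_i \in T then c S`_i else 0)).
  rewrite -(gE (fun x => if x \in T then c x else 0)).
  have /fsubsetP TS' := TS.
  rewrite -(big_fset_incl _ TS') => [|x _ /negPf->]; last by rewrite scale0r.
  by apply: eq_big_seq => x ->.
have [f fK] := choice g_surj.
have g_injB u v : g u = g v -> u = v.
  move=> uv; apply/eqP; rewrite -subr_eq0; apply/eqP/g_inj.
  by rewrite -scaleN1r addrC g_lin uv scaleN1r addNr.
exists f.
  move=> a u v; apply: g_injB; rewrite fK g_lin !fK//.
by exists g => // x; apply: g_injB; rewrite fK.
Qed.

(* Alias of B on which a finite basis is turned into a [falgType] structure. *)
Definition findim_algebra (K : fieldType) (B : algType K) n
  (ax : Vector.axiom n B) : Type := B.

HB.instance Definition _ (K : fieldType) (B : algType K) n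
    (ax : Vector.axiom n B) :=
  GRing.Algebra.copy (findim_algebra ax) B.
HB.instance Definition _ (K : fieldType) (B : algType K) n
    (ax : Vector.axiom n B) :=
  Lmodule_hasFinDim.Build K (findim_algebra ax) ax.
HB.instance Definition _ (K : fieldType) (B : algType K) n
    (ax : Vector.axiom n B) :=
  Algebra_isFalgebra.Build K (findim_algebra ax).

(** The equality is between algebra structures, not just carriers, so that substituting [A] for [B]
    transports the augmentation and the presentation as well. *)
Lemma finite_basis_falgType (K : fieldType) (B : algType K) (S : {fset B}) :
  basis_mod [set: B] [set 0] [set` S] ->
  exists A : falgType K, A = B :> algType K.
Proof.
move=> /finite_basis_vector ax; exists (findim_algebra ax : falgType K).
by case: B S ax => T [].
Qed.

(** * Growth forced by the recurrence *)

(** The invariant [main] is inductive: four times the recurrence with [4 * r <= d ^ 2] gives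
    [4 c_{n+2} >= 4 d c_{n+1} - d^2 c_n + 4], and [d] times the invariant gives
    [d^2 c_n <= 2 d c_{n+1} - 2 d]. *)
Lemma golod_shafarevich_growth (d r : nat) (c : nat -> nat) :
  (0 < d)%N -> (4 * r <= d ^ 2)%N -> c 0%N = 0%N -> c 1%N = 1%N ->
  (forall n, d * c n.+1 + 1 <= c n.+2 + r * c n)%N ->
  forall n, (c n < c n.+1)%N.
Proof.
move=> d0 rd c0 c1 crec.
have main n : (d * c n + 2 <= 2 * c n.+1)%N.
  elim: n => [|n IH]; first by rewrite c0 c1 muln0.
  have := crec n.
  have : (d * (d * c n + 2) <= d * (2 * c n.+1))%N by rewrite leq_mul2l IH orbT.
  have : (4 * r * c n <= d ^ 2 * c n)%N by rewrite leq_mul2r rd orbT.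
  nia.
(* For [d >= 2] the invariant yields [c n < c n.+1] directly. For [d = 1] it is too weak, but then
   [4 * r <= 1] forces [r = 0] and the recurrence itself gives strict growth. *)
case: d d0 rd crec main => // -[_ rd crec _ [|n]|d _ _ _ main n].
- by rewrite c0 c1.
- have r0 : r = 0%N by lia.
  by have := crec n; rewrite r0; lia.
- by have := main n; nia.
Qed.

(** * Linear independence modulo a subspace *)

Definition scalar_comb (K : fieldType) (V : lmodType K) (X : finType)
  (g : X -> V) (k : {ffun X -> K^o}) : V := \sum_x (k x : K) *: g x.

Fact scalar_comb_is_linear (K : fieldType) (V : lmodType K) (X : finType)
  (g : X -> V) : linear (scalar_comb g).
Proof.
move=> a u v; rewrite /scalar_comb scaler_sumr -big_split.
by apply: eq_bigr => x _; rewrite !ffunE scalerDl scalerA.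
Qed.
HB.instance Definition _ (K : fieldType) (V : lmodType K) (X : finType)
    (g : X -> V) :=
  GRing.isLinear.Build K {ffun X -> K^o} V _ (scalar_comb g)
    (scalar_comb_is_linear g).

Section IndependenceModulo.
Variables (K : fieldType) (vT : vectType K) (X : finType) (g : X -> vT).
Variables (V W : {vspace vT}).

Let phi : 'Hom({ffun X -> K^o}, vT) := linfun (scalar_comb g).

Let dim_phi : (\dim (lker phi) + \dim (limg phi) = #|X|)%N.
Proof.
rewrite -{1}(capfv (lker phi)) limg_ker_dim dimvf.
by rewrite /dim /= muln1.
Qed.

(** Independence modulo [W] makes [phi] injective with image meeting [W] trivially, so [W] and the
    image form a direct sum inside [V]. *)
Lemma dim_independent_mod :
  (forall x, g x \in V) -> (W <= V)%VS ->
  (forall k, scalar_comb g k \in W -> k = 0) -> (\dim W + #|X| <= \dim V)%N.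
Proof.
move=> gV WV gind.
have ker0 : lker phi = 0%VS.
  apply/eqP; rewrite -subv0; apply/subvP => k; rewrite memv_ker lfunE /= memv0.
  by move=> /eqP k0; apply/eqP/gind; rewrite k0 mem0v.
have cap0 : (W :&: limg phi = 0)%VS.
  apply/eqP; rewrite -subv0; apply/subvP => v.
  rewrite memv_cap => /andP[vW /memv_imgP[k _ vE]].
  by move: vW; rewrite vE lfunE => /= /gind ->; rewrite linear0 mem0v.
rewrite -dim_phi ker0 dimv0 add0n -dimv_disjoint_sum//.
apply: dimvS; rewrite subv_add WV; apply/subvP => v /memv_imgP[k _ ->].
by rewrite lfunE; apply: memv_suml => x _; apply: memvZ.
Qed.

(** Since [V] lies in [limg phi + W], the dimension bound leaves no room for a kernel of [phi] or
    for an intersection of its image with [W]. *)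
Lemma independent_mod_of_dim :
  (forall v, v \in V -> exists k, v - scalar_comb g k \in W) ->
  (\dim W + #|X| <= \dim V)%N ->
  forall k, scalar_comb g k \in W -> k = 0.
Proof.
move=> gspan dimV.
have /dimvS VW : (V <= limg phi + W)%VS.
  apply/subvP => v /gspan[k vk]; rewrite -(subrK (scalar_comb g k) v) addrC.
  by apply: memv_add => //; rewrite -[scalar_comb g k]lfunE memv_img ?memvf.
have := dimv_sum_cap (limg phi) W; have := dim_phi => H1 H2.
have /eqP : \dim (lker phi) = 0%N by lia.
rewrite dimv_eq0 => /lker0P phi_inj.
have /eqP : \dim (limg phi :&: W) = 0%N by lia.
rewrite dimv_eq0 => /eqP cap0 k kW; apply: phi_inj; rewrite linear0.
by apply/eqP; rewrite -memv0 -cap0 memv_cap memv_img ?memvf// lfunE.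
Qed.

End IndependenceModulo.

(** The basis [E] modulo [W] is only equipotent to [X]; it is replaced by a finite set [S] with as
    many elements as [X]. *)
Lemma quotient_dim_eq_leq (K : fieldType) (vT : vectType K)
    (V W : {vspace vT}) (T : choiceType) (X : {fset T}) :
  (W <= V)%VS ->
  quotient_dim_eq [set v | v \in V] [set v | v \in W] [set` X] ->
  (\dim W + #|` X| <= \dim V)%N.
Proof.
move=> WV [E [[EV _ Eind] EX]].
have /finite_fsetP[S ES] : finite_set E.
  by rewrite (eq_finite_set EX).
rewrite {}ES in EV Eind EX.
have -> : #|` X| = #|` S|.
  by apply/card_eq_fsetP; rewrite -(card_eql EX); apply/card_eq_fsetP.
rewrite cardfE; apply: (@dim_independent_mod _ _ S val).
- by move=> x; apply: (EV _ (valP x)).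
- by [].
move=> k kW; apply/ffunP => x; rewrite ffunE.
pose c v := if insub v is Some y then k y else 0.
have cE (y : S) : c (val y) = k y by rewrite /c valK.
rewrite -cE; apply: (Eind S) (valP x) => //=.
rewrite big_seq_fsetE /=.
suff -> : \sum_(y : S) c (val y) *: val y = scalar_comb val k by [].
by apply: eq_bigr => y _; rewrite cE.
Qed.

(** * Finite powers of the algebra and left combinations *)

Definition left_comb (A : nzRingType) (X : finType) (g : X -> A)
  (u : {ffun X -> A}) : A := \sum_x u x * g x.

Fact left_comb_is_linear (K : fieldType) (A : algType K) (X : finType)
  (g : X -> A) : linear (left_comb g).
Proof.
move=> a u v; rewrite /left_comb scaler_sumr -big_split.
by apply: eq_bigr => x _; rewrite !ffunE mulrDl scalerAl.
Qed.
HB.instance Definition _ (K : fieldType) (A : algType K) (X : finType)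
    (g : X -> A) :=
  GRing.isLinear.Build K {ffun X -> A} A _ (left_comb g)
    (left_comb_is_linear g).

(** The vector is fixed and the scalar varies, so that the image of this map is the left submodule
    generated by [v]. *)
Definition left_mul_ffun (A : nzRingType) (X : finType) (v : {ffun X -> A})
  (a : A) : {ffun X -> A} := [ffun x => a * v x].

Fact left_mul_ffun_is_linear (K : fieldType) (A : algType K) (X : finType)
  (v : {ffun X -> A}) : linear (left_mul_ffun v).
Proof.
by move=> a b c; apply/ffunP => x; rewrite !ffunE mulrDl scalerAl.
Qed.
HB.instance Definition _ (K : fieldType) (A : algType K) (X : finType)
    (v : {ffun X -> A}) :=
  GRing.isLinear.Build K A {ffun X -> A} _ (left_mul_ffun v)
    (left_mul_ffun_is_linear v).

Lemma left_comb_mul (A : nzRingType) (X : finType) (g : X -> A) u a :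
  left_comb g (left_mul_ffun u a) = a * left_comb g u.
Proof.
by rewrite mulr_sumr; apply: eq_bigr => x _; rewrite ffunE mulrA.
Qed.

Lemma leq_dim_limg (K : fieldType) (aT rT : vectType K) (f : 'Hom(aT, rT))
  (U : {vspace aT}) : (\dim (f @: U) <= \dim U)%N.
Proof. by rewrite -(limg_ker_dim f U) leq_addl. Qed.

Definition delta_ffun (A : nzRingType) (X : finType) (x : X) : {ffun X -> A} :=
  [ffun y => (y == x)%:R].

Lemma ffun_sum_delta (A : nzRingType) (X : finType) (u : {ffun X -> A}) :
  u = \sum_x left_mul_ffun (delta_ffun A x) (u x).
Proof.
apply/ffunP => y; rewrite sum_ffunE (bigD1 y)//= !ffunE eqxx mulr1.
by rewrite big1 ?addr0// => x xy; rewrite !ffunE eq_sym (negPf xy) mulr0.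
Qed.

Section PowerSpace.
Variables (K : fieldType) (A : falgType K) (X : finType).

(** The power [V^X] inside [A^X], written as a sum of images of [V] so that its dimension is bounded
    summand by summand. *)
Definition ffunv (V : {vspace A}) : {vspace {ffun X -> A}} :=
  (\sum_x linfun (left_mul_ffun (delta_ffun A x)) @: V)%VS.

Lemma mem_ffunv (V : {vspace A}) (u : {ffun X -> A}) :
  (forall x, u x \in V) -> u \in ffunv V.
Proof.
move=> uV; rewrite [u]ffun_sum_delta; apply: memv_sumr => x _.
by rewrite -[left_mul_ffun _ _]lfunE memv_img.
Qed.

Lemma dim_ffunv (V : {vspace A}) : (\dim (ffunv V) <= #|X| * \dim V)%N.
Proof.
rewrite (leq_trans (dimv_leq_sum _ _ _))// -sum_nat_const.
by apply: leq_sum => x _; apply: leq_dim_limg.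
Qed.

End PowerSpace.

(** * Dimension count for a presentation and for powers of the ideal *)

Section Presentation.
Variables (K : fieldType) (A : falgType K) (I : {vspace A}).
Variables (X R : finType) (g : X -> A) (rho : R -> {ffun X -> A}).

Hypothesis gI : limg (linfun (left_comb g)) = I.
Hypothesis rho_ker : (lker (linfun (left_comb g)) <=
  \sum_r limg (linfun (left_mul_ffun (rho r))))%VS.
Hypothesis rhoI : forall r x, rho r x \in I.

Let p := linfun (left_comb g).
Let D r := linfun (left_mul_ffun (rho r)).

(** This is the truncated exact sequence counted without quotients: a complement of [U] stands for
    [A / U], and rank-nullity for [p] is applied to [V^X + lker p]. *)
Lemma dim_presentation (U : {vspace A}) :
  (U * I * fullv <= U * I)%VS ->
  (#|X| * \dim {:A} + \dim (U * I * I) + #|R| * \dim U <=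
   #|X| * \dim (U * I) + #|R| * \dim {:A} + \dim I)%N.
Proof.
set V := (U * I)%VS => Vr.
have kerE : (\dim (lker p) + \dim I = #|X| * \dim {:A})%N.
  by rewrite -gI -[lker p]capfv limg_ker_dim dimvf [RHS]/= dimvf.
(* Adding the kernel leaves the image unchanged and lets the whole of [lker p] be subtracted in
   rank-nullity. *)
have VI : (V * I <= p @: (ffunv X V + lker p))%VS.
  apply: subv_trans (limgS _ (addvSl _ _)).
  apply/prodvP => a b aV; rewrite -gI => /memv_imgP[u _ ->].
  rewrite lfunE /= -left_comb_mul -[left_comb g _]lfunE; apply: memv_img.
  apply: mem_ffunv => x; rewrite ffunE; apply: (subvP Vr).
  by rewrite memv_mul ?memvf.
(* Scalars are split along [U + U^C]. As the entries of [rho r] lie in [I], the multiples by [U]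
   fall into [V^X], and only those by [U^C] remain to be counted. *)
have ker_le : (lker p <= ffunv X V + \sum_r D r @: U^C)%VS.
  apply: (subv_trans rho_ker); apply/subv_sumP => r _.
  rewrite -/(D r) -(addv_complf U) limgD; apply: addvS.
    apply/subvP => _ /memv_imgP[a aU ->]; apply: mem_ffunv => x.
    by rewrite lfunE /= ffunE memv_mul.
  exact: (sumv_sup r).
have dC : (\dim (\sum_r D r @: U^C) <= #|R| * \dim U^C)%N.
  rewrite (leq_trans (dimv_leq_sum _ _ _))// -sum_nat_const.
  by apply: leq_sum => r _; apply: leq_dim_limg.
have := limg_ker_dim p (ffunv X V + lker p).
rewrite (capv_idPr (addvSr _ _)).
have := dimvS VI.
have : (\dim (ffunv X V + lker p) <= #|X| * \dim V + #|R| * \dim U^C)%N.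
  apply: leq_trans (_ : \dim (ffunv X V + \sum_r D r @: U^C) <= _)%N.
    by apply: dimvS; rewrite subv_add addvSl ker_le.
  by rewrite (leq_trans (dimv_add_leqif _ _))// leq_add ?dim_ffunv.
have : (#|R| * \dim U^C + #|R| * \dim U = #|R| * \dim {:A})%N.
  by rewrite -mulnDr dimv_compl subnK// dimvS ?subvf.
(* The dimensions are named because [lia] does not identify convertible terms
   built with different structure instances. *)
move: kerE; set N := \dim {:A}; set k := \dim (lker p); set s := \dim (_ + _).
set vi := \dim (V * I); set v := \dim V; set u := \dim U.
set im := \dim (p @: _); lia.
Qed.

End Presentation.

Fixpoint ideal_power (K : fieldType) (A : falgType K) (I : {vspace A}) n :=
  if n is m.+1 then (ideal_power I m * I)%VS else fullv.

Lemma ideal_power_right n (K : fieldType) (A : falgType K) (I : {vspace A}) :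
  (I * fullv <= I)%VS -> (ideal_power I n * fullv <= ideal_power I n)%VS.
Proof.
move=> Ir; case: n => [|n]; first exact: subvf.
by rewrite /= -prodvA prodvSr.
Qed.

Lemma not_finite_dim (K : fieldType) (A : falgType K) (I : {vspace A})
    (X R : finType) (g : X -> A) (rho : R -> {ffun X -> A}) :
  (\dim I).+1 = \dim {:A} -> (I * fullv <= I)%VS ->
  limg (linfun (left_comb g)) = I ->
  (lker (linfun (left_comb g)) <=
    \sum_r limg (linfun (left_mul_ffun (rho r))))%VS ->
  (forall r x, rho r x \in I) ->
  (0 < #|X|)%N -> (4 * #|R| <= #|X| ^ 2)%N -> False.
Proof.
move=> dimI Ir gI rho_ker rhoI X0 RX.
pose c n := (\dim {:A} - \dim (ideal_power I n))%N.
(* The first power is [fullv * I]; it equals [I] because the image of [left_comb] is a left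
   ideal. *)
have Il : (fullv * I = I)%VS.
  apply/eqP; rewrite eqEsubv; apply/andP; split; last first.
    by apply/subvP => a aI; rewrite -[a]mul1r memv_mul ?memvf.
  apply/prodvP => a b _; rewrite -gI => /memv_imgP[u _ ->].
  by rewrite lfunE /= -left_comb_mul -[left_comb g _]lfunE memv_img ?memvf.
have cE n : (c n + \dim (ideal_power I n) = \dim {:A})%N.
  by rewrite subnK// dimvS ?subvf.
have c_lt n : (c n < c n.+1)%N.
  move: n; apply: (golod_shafarevich_growth X0 RX).
  - by rewrite /c subnn.
  - by rewrite /c /= Il -dimI subSnn.
  move=> n.
  (* With dimensions rewritten as [\dim {:A}] minus codimensions, the count becomes the recurrence;
     its [+ 1] is the codimension of [I]. *)
  have := dim_presentation (U := ideal_power I n) gI rho_ker rhoI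
    (ideal_power_right n.+1 Ir).
  have := congr1 (muln #|R|) (cE n); have := congr1 (muln #|X|) (cE n.+1).
  have := cE n.+2; rewrite !mulnDr /=.
  move: dimI; set N := \dim {:A}; set i := \dim I.
  set j0 := \dim (ideal_power I n).
  by set j2 := \dim (_ * I); set j1 := \dim (_ * I); lia.
have c_ge n : (n <= c n)%N by elim: n => // n /leq_ltn_trans; apply.
by have := c_ge (\dim {:A}).+1; have := cE (\dim {:A}).+1; lia.
Qed.

(** * From the augmented algebra and its presentation to the dimension count *)

Lemma ideal_square_prodv (K : fieldType) (A : falgType K) (I : {vspace A}) :
  ideal_square [set x | x \in I] = [set x | x \in (I * I)%VS].
Proof.
apply/seteqP; split=> x /=.
  move=> [s [sI ->]]; rewrite big_seq; apply: memv_suml => q /sI[].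
  exact: memv_mul.
(* Unlocking exposes the product space as the span of products of basis vectors of [I]. *)
rewrite unlock => /(coord_span (X := in_tuple _)) ->.
apply: big_ind => [|y z [s [sI ->]] [t [tI ->]]|i _].
- by exists [::]; rewrite big_nil.
- exists (s ++ t); rewrite big_cat; split=> // q.
  by rewrite mem_cat => /orP[/sI|/tI].
set k := coord _ _ _; set v := _`_i.
have /allpairsP[[a b] /= [aI bI ->]] : v \in allpairs *%R (vbasis I) (vbasis I).
  by rewrite mem_nth.
(* Sums in [ideal_square] carry no coefficients, so the scalar is absorbed into the left factor. *)
exists [:: (k *: a, b)]; rewrite big_seq1 /= scalerAl; split=> // q.
by rewrite inE => /eqP-> /=; rewrite memvZ ?vbasis_mem.
Qed.

Lemma left_comb_delta (A : nzRingType) (X : finType) (g : X -> A) x :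
  left_comb g (delta_ffun A x) = g x.
Proof.
rewrite /left_comb (bigD1 x)//= ffunE eqxx mul1r big1 ?addr0// => y yx.
by rewrite ffunE (negPf yx) mul0r.
Qed.

Lemma linear_ffun_comb (A : nzRingType) (V : lmodType A) (X : finType)
    (f : {linear {ffun X -> A^o} -> V}) u :
  f u = \sum_x u x *: f [ffun y => (y == x)%:R].
Proof.
rewrite {1}[u]ffun_sum_delta linear_sum; apply: eq_bigr => x _.
by rewrite -linearZ; congr (f _); apply/ffunP => y; rewrite !ffunE.
Qed.

(** The relations [rho r] are the images under [d] of the basis vectors. Replacing [A^o] by [A]
    makes the [K]-linear structure available. *)
Lemma generating_relatingP (A : nzRingType) (I : set A) (X : {fset A})
    (R : finType) : generating_relating I X R ->
  exists rho : R -> {ffun X -> A},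
    [/\ forall r, left_comb val (rho r) = 0,
        forall u : {ffun X -> A}, left_comb val u = 0 ->
          exists w : R -> A, u = \sum_r left_mul_ffun (rho r) (w r)
      & range (left_comb (fun x : X => val x)) = I].
Proof.
move=> [d [p [pX d_ker p_range]]].
have pE : p = left_comb val :> (_ -> _).
  by apply/funext => u; rewrite linear_ffun_comb; apply: eq_bigr => x _;
    rewrite pX.
exists (fun r => d [ffun y => (y == r)%:R]); split.
- move=> r; rewrite -pE.
  suff : [set u | p u = 0] (d [ffun y => (y == r)%:R]) by [].
  by rewrite -d_ker; exists [ffun y => (y == r)%:R].
- move=> u; rewrite -pE => u0; have : [set u | p u = 0] u by [].
  rewrite -d_ker => -[w _ <-]; exists w; rewrite linear_ffun_comb.
  by apply: eq_bigr => r _; apply/ffunP => x; rewrite !ffunE.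
- by rewrite -pE.
Qed.

Lemma golod_shafarevich (K : fieldType) (A : falgType K)
    (eps : {lrmorphism A -> K^o}) (X : {fset A}) (R : finType) :
  generating_relating (augmentation_ideal eps) X R -> (0 < #|` X|)%N ->
  quotient_dim_eq (augmentation_ideal eps)
    (ideal_square (augmentation_ideal eps)) [set` X] ->
  (#|` X| ^ 2 < 4 * #|R|)%N.
Proof.
set I := lker (linfun eps : 'Hom(A, K^o)).
have memI x : (x \in I) = (eps x == 0) by rewrite memv_ker lfunE.
have -> : augmentation_ideal eps = [set x | x \in I].
  by apply/seteqP; split=> x /=; rewrite memI => /eqP.
rewrite ideal_square_prodv => /generating_relatingP[rho [rho0 rhoE Xrange]].
move=> X0 hdim.
rewrite ltnNge; apply/negP => RX.
have Ir : (I * fullv <= I)%VS.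
  by apply/prodvP => a b; rewrite !memI rmorphM /= => /eqP-> _; rewrite mul0r.
have II : (I * I <= I)%VS by apply: subv_trans Ir; rewrite prodvSr ?subvf.
have dimI : (\dim I).+1 = \dim {:A}.
  rewrite -(limg_ker_dim (linfun eps : 'Hom(A, K^o)) fullv) capfv.
  suff -> : limg (linfun eps : 'Hom(A, K^o)) = 1%VS.
    by rewrite dim_vline oner_neq0 addn1.
  apply/eqP; rewrite -regular_fullv eqEsubv subvf regular_fullv -memvE.
  have <- : linfun eps 1 = 1 :> K^o by rewrite lfunE; exact: rmorph1.
  by rewrite memv_img ?memvf.
rewrite cardfE in X0 RX.
have Xrange' v : v \in I -> exists u : {ffun X -> A}, v = left_comb val u.
  move=> vI; have : [set x | x \in I] v by [].
  by rewrite -Xrange => -[u _ <-]; exists u.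
have XI (u : {ffun X -> A}) : left_comb val u \in I.
  suff : [set x | x \in I] (left_comb val u) by [].
  by rewrite -Xrange; exists u.
have valI (x : X) : val x \in I.
  have <- : left_comb val (delta_ffun A x) = val x by rewrite left_comb_delta.
  exact: XI.
(* Each [u x - eps (u x)] lies in [I], and so does [x]; hence coefficients may be replaced by their
   augmentations modulo [I * I]. *)
have Xeps (u : {ffun X -> A}) :
    left_comb val u - scalar_comb val [ffun x => eps (u x)] \in (I * I)%VS.
  rewrite /left_comb /scalar_comb -sumrB; apply: memv_suml => x _.
  rewrite ffunE -[X in _ - _ *: X]mul1r scalerAl -mulrBl memv_mul// memI.
  by rewrite linearB linearZ /= rmorph1 /= [_ *: _]mulr1 subrr.
have Xind k : scalar_comb (fun x : X => val x) k \in (I * I)%VS -> k = 0.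
  apply: (@independent_mod_of_dim _ _ _ _ I) => [v /Xrange'[u ->]|].
    by exists [ffun x => eps (u x)].
  by rewrite -cardfE; apply: quotient_dim_eq_leq.
apply: (@not_finite_dim _ _ I _ _ (fun x : X => val x) rho) => //.
- apply/vspaceP => v; apply/idP/idP => [/memv_imgP[u _ ->]|/Xrange'[u ->]].
    by rewrite lfunE; apply: XI.
  by rewrite -[left_comb _ _]lfunE memv_img ?memvf.
- apply/subvP => u; rewrite memv_ker lfunE => /eqP/rhoE[w ->].
  by apply: memv_sumr => r _; rewrite -[left_mul_ffun _ _]lfunE memv_img ?memvf.
(* By [Xeps], the relation [rho r] gives a scalar combination of [X] in [I * I]; its coefficients
   [eps (rho r x)] vanish by [Xind]. *)
- move=> r x; rewrite memI; have := Xeps (rho r).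
  rewrite rho0 sub0r memvN => /Xind/ffunP/(_ x).
  by rewrite !ffunE => ->.
Qed.

Theorem theorem1p1 (K : fieldType) (B : algType K)
    (eps : {lrmorphism B -> K^o}) (X : {fset B}) (R : finType)
    (hXR : generating_relating (augmentation_ideal eps) X R)
    (hX1 : (1 <= #|` X|)%N)
    (hdim : quotient_dim_eq (augmentation_ideal eps)
              (ideal_square (augmentation_ideal eps)) [set` X])
    (hR : #|R|%:R <= 4%:R^-1 * (#|` X|%:R) ^+ 2 :> rat) :
  dim_ge_aleph0 B.
Proof.
have [E EB] := exists_basis B; exists E; split=> //.
(* Were the basis finite, [B] would be a [falgType], and [golod_shafarevich] would contradict
   [hR]. *)
apply/infiniteP => /finite_fsetP[S ES]; rewrite {}ES in EB.
have [A AB] := finite_basis_falgType EB; subst B.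
have := golod_shafarevich hXR hX1 hdim.
move: hR; rewrite mulrC ler_pdivlMr// -natrX -natrM ler_nat mulnC => hR.
by rewrite ltnNge hR.
Qed.
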